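(* Let $CSG_{n,k}$ be the community star graph: the star graph on $n$ vertices (a center $c$ adjacent to $n-1$ leaves) in which $k$ edges have weight $1$ and the remaining $n-k-1$ edges have weight $w$. Let $x$ and $y$ be leaves incident to an edge of weight $1$ and of weight $w$, respectively. For $\alpha,\beta\in\mathbb{R}$ take $q_n=n^{\alpha}$, $w=w_n=n^{\beta}$ and $k\ge1$ constant. Then $$\lim_{n\to\infty}U_{q_n}^{(CSG_{n,k})}(c,x)=\begin{cases}0&\alpha<0\\[1mm] \frac12&\alpha=0,\ \beta>-1\\[1mm] \frac{k+3}{2k+8}&\alpha=0,\ \beta=-1\\[1mm] \frac{k+1}{2k+4}&\alpha=0,\ \beta<-1\\[1mm]1&\alpha>0\end{cases}$$ and $$\lim_{n\to\infty}U_{q_n}^{(CSG_{n,k})}(c,y)=\begin{cases}0&\alpha<\beta\\ \frac12&\alpha=\beta\\1&\alpha>\beta.\end{cases}$$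
   Context: An undirected weighted graph is considered as a directed graph in which each undirected edge gives two directed edges (one per orientation) of the same weight. A rooted spanning forest of a finite directed graph $G$ is a subset $F$ of its directed edges such that each vertex has at most one outgoing edge in $F$ and $F$ contains no directed cycle; its roots are the vertices without outgoing edge in $F$ and $r(F)$ is the number of roots. For $q>0$, the random rooted spanning forest $\Phi_q$ of $G$ has law $\mathbb{P}(\Phi_q=F)=q^{r(F)}w(F)/Z_G(q)$, where $w(F)=\prod_{e\in F}w(e)$ and $Z_G(q)=\sum_Fq^{r(F)}w(F)$ (sum over rooted spanning forests). $U_q^{(G)}(x,y)$ is the probability that $x$ and $y$ belong to different trees (connected components, ignoring orientation) of $\Phi_q$. *)

(* Defs.v *)
From mathcomp Require Import all_boot all_order all_algebra.
From mathcomp Require Import all_classical all_reals all_analysis.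

Set Implicit Arguments.
Unset Strict Implicit.
Unset Printing Implicit Defensive.

Import Order.TTheory GRing.Theory Num.Theory.
Import numFieldNormedType.Exports.

Local Open Scope ring_scope.

Record wdigraph (R : Type) (V : finType) := WDigraph {
  arcs : {set V * V};
  arc_weight : V * V -> R
}.

(* An undirected edge is the set of its endpoints. *)
Record wgraph (R : Type) (V : finType) := WGraph {
  edges : {set {set V}};
  edge_weight : {set V} -> R
}.

Definition digraph_of (R : Type) (V : finType) (G : wgraph R V) :
    wdigraph R V :=
  WDigraph [set a : V * V | [set a.1; a.2] \in edges G]
           (fun a => edge_weight G [set a.1; a.2]).

Section Forests.
Variables (R : realType) (V : finType).
Implicit Types (G : wdigraph R V) (F : {set V * V}).

Definition arc_rel F : rel V := [rel u v | (u, v) \in F].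

Definition out_arcs F (v : V) : {set V * V} := [set a in F | a.1 == v].

(* Directed cycles may have length 1 (loops) or 2 (u -> v -> u). *)
Definition acyclic F : Prop :=
  ~ exists2 s : seq V, s != [::] & ucycle (arc_rel F) s.

Definition rooted_forest G F : bool :=
  [&& F \subset arcs G, [forall v, #|out_arcs F v| <= 1]%N & `[< acyclic F >]].

Definition forest_roots F : {set V} := [set v | out_arcs F v == finset.set0].

Definition forest_weight G F : R := \prod_(a in F) arc_weight G a.

Definition Zforest G (q : R) : R :=
  \sum_(F : {set V * V} | rooted_forest G F) q ^+ #|forest_roots F| * forest_weight G F.

Definition forest_law G (q : R) F : R :=
  if rooted_forest G F then
    q ^+ #|forest_roots F| * forest_weight G F / Zforest G q
  else 0.

Definition same_tree F : rel V :=
  connect [rel u v | arc_rel F u v || arc_rel F v u].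

Definition U G (q : R) (x y : V) : R :=
  \sum_(F : {set V * V} | ~~ same_tree F x y) forest_law G q F.

End Forests.

(* The star with n >= 1 vertices lives on [option 'I_n.-1]: the center is
   [None] and the leaves are the [Some i].  At n = 0 this is a one-vertex
   graph. *)
Definition star_vertex (n : nat) : finType := option 'I_n.-1.

Definition star_center (n : nat) : star_vertex n := None.

Definition spokes (n : nat) (A : {set 'I_n.-1}) : {set {set star_vertex n}} :=
  [set [set star_center n; Some i] | i in A]%SET.

(* The leaves in [A] are those joined to the center by an edge of weight 1. *)
Definition csg (R : realType) (n : nat) (A : {set 'I_n.-1}) (w : R) :
    wgraph R (star_vertex n) :=
  WGraph (spokes [set: 'I_n.-1]%SET)
         (fun e => if e \in spokes A then 1 else w).

Definition U_csg (R : realType) (n : nat) (A : {set 'I_n.-1}) (q w : R) :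
    star_vertex n -> star_vertex n -> R :=
  U (digraph_of (csg A w)) q.

(* Main.v *)
Require Import Defs.
From mathcomp Require Import all_boot all_order all_algebra.
From mathcomp Require Import all_classical all_reals all_analysis.
From mathcomp Require Import zify ring lra.
Import Order.TTheory GRing.Theory Num.Theory.
Import numFieldNormedType.Exports.
Local Open Scope ring_scope.

(** A rooted forest of a star is described by the set [D] of leaves that point
    to the center and by the optional leaf [o] to which the center points; the
    only possible directed cycle is [center -> j -> center], so the only
    constraint is that [j] is not in [D] when [o = Some j].  The weight
    [q ^ r(F) * w(F)] is a product of one factor per vertex, hence the sum over
    [D] factors over the leaves: each leaf contributes [q + w_i], except that a
    leaf forced to be a root contributes only [q].  With
    [H = \sum_j w_j / (q + w_j)] this gives

      Z = q * \prod_i (q + w_i) * (1 + H).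

    The center and the leaf [x] lie in different trees exactly when neither
    points to the other, that is when [x] is forced to be a root and is not the
    leaf chosen by the center.  Writing [p = q / (q + w_x)], the same
    computation yields the closed formula [U_star]:

      U(c, x) = p * (1 - (1 - p) / (1 + H)).

    Since [H >= 0], this lies between [p ^ 2] and [p], which settles every case
    where [p] tends to 0 or 1, that is where [q] and [w_x] have different orders
    of growth ([separation_cvg]).  When they are equal, [p = 1/2] and the limit
    is determined by that of [1 / (1 + H)], where

      H = k / (q + 1) + (n - 1 - k) * w / (q + w).

    If [alpha < beta + 1] the second term is of order [n ^ (1 + min(beta -
    alpha, 0))], so [H] diverges ([csg_hub_cvgy]) and the limit is [1/2].  If
    [alpha = 0] and [beta <= -1], then [H] tends to [k/2] plus the limit of
    [n ^ (1 + beta)] ([csg_hub_cvg]), which gives the two [k]-dependent values. *)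

(** * Forest weights as products over vertices *)

Section VertexFactors.
Set Implicit Arguments.
Unset Strict Implicit.
Variables (R : realType) (V : finType) (G : wdigraph R V) (q : R).
Implicit Types F : {set V * V}.

Definition vertex_factor F (v : V) : R :=
  (if out_arcs F v == finset.set0 then q else 1) *
  \prod_(a in out_arcs F v) arc_weight G a.

(** Both sides group the arcs by their source, and every root accounts for one
    power of [q]. *)
Lemma forest_weight_vertex_factors F :
  q ^+ #|forest_roots F| * forest_weight G F = \prod_v vertex_factor F v.
Proof.
rewrite big_split /=; congr (_ * _).
  by rewrite -big_mkcond -prodr_const; apply: eq_bigl => v; rewrite [LHS]inE.
rewrite /forest_weight (partition_big (fun a => a.1) predT) //.
by apply: eq_bigr => v _; apply: eq_bigl => a; rewrite [RHS]inE.
Qed.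

Lemma vertex_factor_root F v : out_arcs F v = finset.set0 -> vertex_factor F v = q.
Proof. by rewrite /vertex_factor => ->; rewrite eqxx big_set0 mulr1. Qed.

Lemma vertex_factor_arc F v a :
  out_arcs F v = finset.set1 a -> vertex_factor F v = arc_weight G a.
Proof.
by rewrite /vertex_factor => ->; rewrite -cards_eq0 cards1 big_set1 mul1r.
Qed.
End VertexFactors.

(** * Rooted forests of a star *)

Section StarForests.
Set Implicit Arguments.
Unset Strict Implicit.
Variables (R : realType) (T : finType).
Implicit Types (o : option T) (D C : {set T}) (F : {set option T * option T}).

Definition star_forest o D : {set option T * option T} :=
  finset (fun a => match a with
    | (Some i, None) => i \in D
    | (None, Some j) => o == Some j
    | _ => false end).

Lemma big_option (idx : R) (op : Monoid.com_law idx) (f : option T -> R) :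
  \big[op/idx]_v f v = op (f None) (\big[op/idx]_i f (Some i)).
Proof.
rewrite (bigD1 None) //=; congr (op _ _).
rewrite (reindex_omap Some id) => [|[i|]] //=.
by apply: eq_bigl => i; rewrite eqxx.
Qed.

Lemma out_arcs_leaf o D i : out_arcs (star_forest o D) (Some i) =
  if i \in D then finset.set1 (Some i, None) else finset.set0.
Proof.
apply/setP => -[[u|] [v|]]; rewrite !inE /=; case: ifP => iD; rewrite !inE //.
- by apply/esym/eqP => -[].
- by rewrite xpair_eqE eqxx andbT; case: eqP => [[->]|]; rewrite ?iD ?andbF.
- by case: eqP => [[->]|]; rewrite ?iD ?andbF.
all: by rewrite ?andbF //; apply/esym/eqP.
Qed.

Lemma out_arcs_center o D : out_arcs (star_forest o D) None =
  if o is Some j then finset.set1 (None, Some j) else finset.set0.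
Proof.
apply/setP => -[[u|] [v|]]; rewrite !inE /= ?andbF ?andbT; case: o => [j|]; rewrite !inE //.
by rewrite xpair_eqE eqxx /= eq_sym.
Qed.

Definition no_two_cycle o D : bool := if o is Some j then j \notin D else true.

(** Along a directed cycle each leaf is followed by the center and the center by
    the leaf it points to, so this leaf would point back to the center. *)
Lemma acyclic_star_forest o D :
  `[< Defs.acyclic (star_forest o D) >] = no_two_cycle o D.
Proof.
apply/asboolP/idP => [acy|ok].
  case: o acy => [j|] //= acy; apply/negP => jD; apply: acy.
  by exists [:: None; Some j] => //; rewrite /ucycle /= /arc_rel /= !inE !eqxx jD.
case=> s s0 /andP[cyc _].
have step v : v \in s -> exists2 v', v' \in s & arc_rel (star_forest o D) v v'.
  by move=> vs; exists (next s v); rewrite ?mem_next ?(next_cycle cyc).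
have leaf i : Some i \in s -> None \in s.
  by move=> /step[[j|] // js]; rewrite /arc_rel /= inE.
have /step[[j|] js] : None \in s.
  case: s s0 {cyc step} leaf => [//|[i|] s] _ leaf; last by rewrite mem_head.
  by apply: (leaf i); rewrite mem_head.
  rewrite /arc_rel /= inE => /eqP oj.
  have [[i|] _] := step _ js; rewrite /arc_rel /= inE // => jD.
  by move: ok; rewrite oj /= jD.
by rewrite /arc_rel /= inE.
Qed.

(** If the leaf [x] and the center do not point to each other, then no arc touches
    [x], so [x] is a component by itself. *)
Lemma same_tree_star_forest o D x :
  same_tree (star_forest o D) None (Some x) = (x \in D) || (o == Some x).
Proof.
apply/idP/idP => [conn|]; last first.
  by move=> h; apply: connect1; rewrite /arc_rel /= !inE orbC.
apply/negPn/negP; rewrite negb_or => /andP[xD ox].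
pose e := arc_rel (star_forest o D).
have cl : fingraph.closed [rel u v | e u v || e v u]
    [pred v | v == Some x].
  move=> [u|] [v|]; rewrite /e /arc_rel /= !inE ?orbF //.
    move=> h; have /negbTE -> // : Some u != Some x.
    by apply: contraL h => /eqP[->]; rewrite negb_or xD ox.
  move=> h; have /negbTE -> // : Some v != Some x.
  by apply: contraL h => /eqP[->]; rewrite negb_or xD ox.
by have := closed_connect cl conn; rewrite !inE eqxx.
Qed.

Section Weighted.
Variables (G : wdigraph R (option T)) (wt : T -> R) (q : R).
Hypothesis arcsE : arcs G = finset (fun a : option T * option T => isSome a.1 != isSome a.2).
Hypothesis weight_in : forall i, arc_weight G (Some i, None) = wt i.
Hypothesis weight_out : forall i, arc_weight G (None, Some i) = wt i.

Lemma rooted_star_forest o D :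
  rooted_forest G (star_forest o D) = no_two_cycle o D.
Proof.
rewrite /rooted_forest acyclic_star_forest.
have -> : star_forest o D \subset arcs G.
  by rewrite arcsE; apply/fintype.subsetP => -[[i|] [j|]]; rewrite !inE.
suff -> : [forall v, (#|out_arcs (star_forest o D) v| <= 1)%N] by [].
apply/forallP => -[i|].
  by rewrite out_arcs_leaf; case: ifP; rewrite ?cards1 ?cards0.
by rewrite out_arcs_center; case: o => [j|]; rewrite ?cards1 ?cards0.
Qed.

Definition forest_code F : option T * {set T} :=
  ([pick j | (None, Some j) \in F], finset (fun i => (Some i, None) \in F)).

Lemma star_forestK o D : forest_code (star_forest o D) = (o, D).
Proof.
rewrite /forest_code; congr (_, _); last by apply/setP => i; rewrite !inE.
case: pickP => [j|none]; first by rewrite inE => /eqP.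
by case: o none => // j /(_ j); rewrite inE eqxx.
Qed.

(** Out-degree at most one makes the leaf picked as target of the center the only
    one. *)
Lemma forest_codeK F : rooted_forest G F ->
  star_forest (forest_code F).1 (forest_code F).2 = F.
Proof.
case/and3P => /fintype.subsetP sub /forallP /(_ None)/card_le1_eqP uniq _.
have noarc u v : isSome u = isSome v -> ((u, v) \in F) = false.
  by move=> uv; apply/negP => /sub; rewrite arcsE !inE uv eqxx.
apply/setP => -[[i|] [j|]]; rewrite !inE /forest_code /= ?inE //; try by rewrite noarc.
case: pickP => [k kF|->] //; apply/eqP/idP => [[<-] //|jF].
by have := uniq (None, Some k) (None, Some j); rewrite !inE kF jF eqxx => /(_ isT isT)[->].
Qed.

Lemma weight_star_forest o D :
  q ^+ #|forest_roots (star_forest o D)| * forest_weight G (star_forest o D) =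
  (if o is Some j then wt j else q) * \prod_i (if i \in D then wt i else q).
Proof.
rewrite forest_weight_vertex_factors big_option /=; congr (_ * _).
  have := out_arcs_center o D; case: o => [j|] out.
    by rewrite (vertex_factor_arc G q out).
  by rewrite (vertex_factor_root G q out).
apply: eq_bigr => i _; have := out_arcs_leaf o D i; case: ifP => _ out.
  by rewrite (vertex_factor_arc G q out).
by rewrite (vertex_factor_root G q out).
Qed.

(** The bijection between forests and pairs [(o, D)], used both for the partition
    function and for the event that a leaf is cut off from the center. *)
Lemma sum_rooted_forests (P : option T -> {set T} -> bool) :
  \sum_(F | rooted_forest G F && P (forest_code F).1 (forest_code F).2)
     q ^+ #|forest_roots F| * forest_weight G F =
  \sum_o (if o is Some j then wt j else q) *
    \sum_(D | no_two_cycle o D && P o D) \prod_i (if i \in D then wt i else q).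
Proof.
rewrite (reindex_onto (fun p => star_forest p.1 p.2) forest_code); last first.
  by move=> F /andP[/forest_codeK].
under [RHS]eq_bigr do rewrite big_distrr.
rewrite (pair_big_dep predT); apply: eq_big => [[c D]|[c D] _].
  by rewrite star_forestK rooted_star_forest eqxx andbT.
exact: weight_star_forest.
Qed.

Hypothesis q_gt0 : 0 < q.
Hypothesis wt_gt0 : forall i, 0 < wt i.

(** Replacing the weight of the leaves in [C] by 0 kills the sets [D] that meet
    [C]; the unrestricted sum over [D] is then the expansion of a product of
    binomials, where a leaf of [C] contributes [q] instead of [q + wt i]. *)
Lemma sum_leaves_avoiding C :
  \sum_(D : {set T} | [disjoint D & C]) \prod_i (if i \in D then wt i else q) =
  \prod_i (q + wt i) * \prod_(i in C) (q / (q + wt i)).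
Proof.
rewrite [X in _ * X]big_mkcond -big_split /=.
rewrite (eq_bigr (fun i => (if i \in C then 0 else wt i) + q)) => [|i _]; last first.
  have := wt_gt0 i; case: ifP => _; rewrite ?mulr1 1?addrC // add0r => wi.
  by rewrite mulrC mulfVK // gt_eqF // addr_gt0.
rewrite bigA_distr big_mkcond; apply: eq_bigr => D _; case: ifP => [dis|].
  apply: eq_bigr => i _; case: ifP => // iD.
  by rewrite (disjointFr dis).
move/negbT; rewrite finset.disjoints_subset => /subsetPn[i iD]; rewrite inE negbK => iC.
by rewrite (bigD1 i) //= iD iC mul0r.
Qed.

Lemma sum_leaves_avoiding1 j :
  \sum_(D : {set T} | j \notin D) \prod_i (if i \in D then wt i else q) =
  \prod_i (q + wt i) * (q / (q + wt j)).
Proof.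
have := sum_leaves_avoiding (finset.set1 j); rewrite big_set1 => <-.
by apply: eq_bigl => D; rewrite disjoint_sym disjoints1.
Qed.

Lemma sum_leaves_avoiding2 j x : j != x ->
  \sum_(D : {set T} | (j \notin D) && (x \notin D))
     \prod_i (if i \in D then wt i else q) =
  \prod_i (q + wt i) * (q / (q + wt j) * (q / (q + wt x))).
Proof.
move=> jx; have := sum_leaves_avoiding (finset.setU (finset.set1 j) (finset.set1 x)).
rewrite big_setU1 ?big_set1 ?inE //= => <-; apply: eq_bigl => D.
by rewrite disjoint_sym finset.disjoints_subset finset.subUset !finset.sub1set !inE.
Qed.

(** The total weight of the forests in which the center is not a root, relative to
    that of the forests in which it is. *)
Definition hub_weight : R := \sum_i wt i / (q + wt i).

Lemma q_wt_neq0 i : q + wt i != 0.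
Proof. by rewrite gt_eqF // addr_gt0. Qed.

Lemma Zforest_star :
  Zforest G q = \prod_i (q + wt i) * q * (1 + hub_weight).
Proof.
have -> : Zforest G q = \sum_o (if o is Some j then wt j else q) *
    \sum_(D | no_two_cycle o D && true) \prod_i (if i \in D then wt i else q).
  by rewrite -(sum_rooted_forests (fun _ _ => true)); apply: eq_bigl => F; rewrite andbT.
rewrite big_option /=.
have -> : \sum_(D : {set T} | true) \prod_i (if i \in D then wt i else q) =
    \prod_i (q + wt i).
  have := sum_leaves_avoiding finset.set0; rewrite big_set0 mulr1 => <-.
  by apply: eq_bigl => D; rewrite disjoint_sym finset.disjoints_subset finset.sub0set.
rewrite mulrDr mulr1 mulrC; congr (_ + _).
rewrite /hub_weight big_distrr; apply: eq_bigr => j _ /=.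
rewrite (eq_bigl (fun D => j \notin D)) => [|D]; last by rewrite andbT.
rewrite sum_leaves_avoiding1; field; exact: q_wt_neq0.
Qed.

(** Either the center is a root and [x] is the only leaf forced to be a root, or
    the center points to some [j != x] and both [j] and [x] are.  The excluded
    choice [j = x] accounts for the term removed from [hub_weight]. *)
Lemma separated_star x :
  \sum_(F | rooted_forest G F && ~~ same_tree F None (Some x))
     q ^+ #|forest_roots F| * forest_weight G F =
  \prod_i (q + wt i) * q * (q / (q + wt x)) *
  (1 + hub_weight - wt x / (q + wt x)).
Proof.
pose P o D := (x \notin D) && (o != Some x).
rewrite (eq_bigl (fun F =>
  rooted_forest G F && P (forest_code F).1 (forest_code F).2)); last first.
  move=> F; apply: andb_id2l => /forest_codeK <-.
  by rewrite same_tree_star_forest negb_or star_forestK.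
rewrite sum_rooted_forests big_option /=.
have -> : hub_weight = wt x / (q + wt x) + \sum_(i | i != x) wt i / (q + wt i).
  by rewrite /hub_weight (bigD1 x).
have -> : \sum_(D : {set T} | P None D) \prod_i (if i \in D then wt i else q) =
    \prod_i (q + wt i) * (q / (q + wt x)).
  by rewrite -sum_leaves_avoiding1; apply: eq_bigl => D; rewrite /P andbT.
set Q := \prod_i (q + wt i).
rewrite (bigD1 x) //= [X in wt x * X]big_pred0 => [|D]; last first.
  by rewrite /P eqxx !andbF.
rewrite mulr0 add0r.
transitivity (q * (Q * (q / (q + wt x))) +
  Q * q * (q / (q + wt x)) * \sum_(i | i != x) wt i / (q + wt i)); last by ring.
congr (_ + _); rewrite big_distrr /=; apply: eq_bigr => j jx.
rewrite (eq_bigl (fun D => (j \notin D) && (x \notin D))) => [|D]; last first.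
  by rewrite /P (inj_eq Some_inj) jx andbT.
by rewrite (sum_leaves_avoiding2 jx) -/Q; ring.
Qed.

Lemma U_star x :
  U G q None (Some x) =
  q / (q + wt x) * (1 - wt x / (q + wt x) / (1 + hub_weight)).
Proof.
rewrite /U.
have -> : \sum_(F | ~~ same_tree F None (Some x)) forest_law G q F =
    (\sum_(F | rooted_forest G F && ~~ same_tree F None (Some x))
     q ^+ #|forest_roots F| * forest_weight G F) / Zforest G q.
  rewrite big_distrl /= big_mkcondl /=; apply: eq_bigr => F _.
  by rewrite /forest_law; case: ifP.
have hub_gt0 : 0 < 1 + hub_weight.
  rewrite ltr_wpDr // sumr_ge0 // => i _.
  by rewrite divr_ge0 // ltW // addr_gt0.
have prod_neq0 : \prod_i (q + wt i) != 0.
  by apply/prodf_neq0 => i _; exact: q_wt_neq0.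
rewrite separated_star Zforest_star; have := q_wt_neq0 x.
move: prod_neq0; set P := \prod_i _; move=> P0 qx.
have := lt0r_neq0 q_gt0; have := lt0r_neq0 hub_gt0.
by move=> *; field; apply/and4P.
Qed.
End Weighted.
End StarForests.

(** * The community star graph *)
Section CommunityStar.
Set Implicit Arguments.
Unset Strict Implicit.
Variables (R : realType) (n : nat) (A : {set 'I_n.-1}) (q w : R).

(** Comparing unordered pairs by membership of each of [u], [v], the center and
    the leaf [i] identifies the edges of the star. *)
Lemma spokesE (B : {set 'I_n.-1}) (u v : star_vertex n) :
  (finset.setU (finset.set1 u) (finset.set1 v) \in spokes B) =
  match u, v with
  | Some i, None | None, Some i => i \in B
  | _, _ => false
  end.
Proof.
apply/imsetP/idP => [[i iB /setP uvE]|].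
  have := uvE u; have := uvE v; have := uvE (Some i); have := uvE None.
  rewrite !inE !eqxx ?orbT.
  by case: u v {uvE} => [u|] [v|] //=;
    rewrite ?inE ?orbF //= => _ /eqP[<-].
case: u v => [i|] [j|] // iB; [exists i => //|by exists j].
by rewrite finset.setUC.
Qed.

Definition csg_wt (i : 'I_n.-1) : R := if i \in A then 1 else w.

Lemma csg_arcs : arcs (digraph_of (csg A w)) =
  finset (fun a : star_vertex n * star_vertex n => isSome a.1 != isSome a.2).
Proof.
by apply/setP => -[[i|] [j|]]; rewrite [LHS]inE [RHS]inE spokesE /= ?finset.in_setT.
Qed.

Lemma hub_weight_csg : hub_weight csg_wt q =
  #|A|%:R / (q + 1) + (n.-1 - #|A|)%:R * (w / (q + w)).
Proof.
rewrite /hub_weight (bigID (mem A)) /=; congr (_ + _).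
  rewrite (eq_bigr (fun=> 1 / (q + 1))); last by rewrite /csg_wt => i ->.
  by rewrite sumr_const div1r mulr_natl.
rewrite (eq_bigr (fun=> w / (q + w))); last first.
  by rewrite /csg_wt => i /negbTE ->.
rewrite sumr_const mulr_natl; congr (_ *+ _).
have AC := etrans (cardC A) (card_ord _).
have -> : (n.-1 - #|A|)%N = #|[predC A]| by rewrite -[X in (X - _)%N]AC addKn.
by apply: eq_card => i; rewrite !inE.
Qed.

Lemma U_csgE i : 0 < q -> 0 < w -> let p := q / (q + csg_wt i) in
  U_csg A q w (star_center n) (Some i) =
  p * (1 - (1 - p) / (1 + (#|A|%:R / (q + 1) + (n.-1 - #|A|)%:R * (w / (q + w))))).
Proof.
move=> q0 w0 /=; have wt0 j : 0 < csg_wt j by rewrite /csg_wt; case: ifP.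
have := @U_star R _ (digraph_of (csg A w)) csg_wt q csg_arcs _ _ q0 wt0 i.
rewrite hub_weight_csg /U_csg => ->; try by move=> j; rewrite /= spokesE.
congr (_ * (1 - _ / _)); have := q_wt_neq0 q0 wt0 i.
by move=> ?; field.
Qed.

End CommunityStar.

(** * Limits *)

Section Limits.
Variable R : realType.
Local Open Scope classical_set_scope.
Implicit Types a b c : R.

Lemma natpow_cvg0 a : a < 0 -> n%:R `^ a @[n --> \oo] --> (0 : R).
Proof.
move=> a0; apply/cvgr0Pnorm_lt => e e0; near=> n.
have b0 : 0 < - a by rewrite oppr_gt0.
have big : (e^-1) `^ (- a)^-1 < n%:R by near: n; exact: nbhs_infty_gtr.
rewrite ger0_norm ?powR_ge0 // -[a]opprK powRN invf_plt ?posrE //; last first.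
  by rewrite powR_gt0 // (le_lt_trans _ big) // powR_ge0.
have -> : e^-1 = (e^-1 `^ (- a)^-1) `^ (- a).
  by rewrite -powRrM mulVf ?gt_eqF // powRr1 // invr_ge0 ltW.
by rewrite gt0_ltr_powR // ?nnegrE ?powR_ge0.
Unshelve. all: by end_near. Qed.

(** For [q = n ^ a] and a leaf of weight [n ^ b], this is the quantity
    [q / (q + w_x)] of the closed formula. *)
Definition natshare a b (n : nat) : R := n%:R `^ a / (n%:R `^ a + n%:R `^ b).

Lemma natshareE a b n : (0 < n)%N -> natshare a b n = (1 + n%:R `^ (b - a))^-1.
Proof.
move=> n0; have n0' : (0 : R) < n%:R by rewrite ltr0n.
have a0 := powR_gt0 a n0'; have b0 := powR_gt0 b n0'.
rewrite /natshare powRB; last by rewrite (gt_eqF n0') implybT.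
move: (n%:R `^ a) (n%:R `^ b) a0 b0 => u v u0 v0; field.
by rewrite !gt_eqF // addr_gt0.
Qed.

Lemma natshare_id a n : (0 < n)%N -> natshare a a n = 2^-1.
Proof. by move=> n0; rewrite natshareE // subrr powRr0. Qed.

Lemma natshare_ge0 a b n : 0 <= natshare a b n.
Proof. by rewrite divr_ge0 ?addr_ge0 ?powR_ge0. Qed.

Lemma natshare_le1 a b n : (0 < n)%N -> natshare a b n <= 1.
Proof.
by move=> n0; rewrite natshareE // invf_le1 ?lerDl ?powR_ge0 // ltr_wpDr ?powR_ge0.
Qed.

Lemma natshare_cvg1 a b : b < a -> natshare a b n @[n --> \oo] --> (1 : R).
Proof.
move=> ba; have n0 : \forall n \near \oo, (1 + n%:R `^ (b - a))^-1 = natshare a b n.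
  by near=> n; rewrite natshareE //; near: n; exact: nbhs_infty_gt.
apply: cvg_trans; first by apply: near_eq_cvg n0.
suff: (1 + n%:R `^ (b - a))^-1 @[n --> \oo] --> ((1 + 0)^-1 : R).
  by rewrite addr0 invr1.
apply: cvgV; first by rewrite addr0 oner_neq0.
by apply: cvgD; [exact: cvg_cst|apply: natpow_cvg0; rewrite subr_lt0].
Unshelve. all: by end_near. Qed.

Lemma natshareC a b n : (0 < n)%N -> natshare b a n = 1 - natshare a b n.
Proof.
move=> n0; have n0' : (0 : R) < n%:R by rewrite ltr0n.
have a0 := powR_gt0 a n0'; have b0 := powR_gt0 b n0'.
rewrite /natshare; move: (n%:R `^ a) (n%:R `^ b) a0 b0 => u v u0 v0; field.
by rewrite !gt_eqF // addr_gt0.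
Qed.

Lemma natshare_cvg0 a b : a < b -> natshare a b n @[n --> \oo] --> (0 : R).
Proof.
move=> ab; have n0 : \forall n \near \oo, 1 - natshare b a n = natshare a b n.
  by near=> n; rewrite (natshareC b a) //; near: n; exact: nbhs_infty_gt.
apply: cvg_trans; first by apply: near_eq_cvg n0.
suff: 1 - natshare b a n @[n --> \oo] --> (1 - 1 : R) by rewrite subrr.
by apply: cvgB; [exact: cvg_cst|exact: natshare_cvg1].
Unshelve. all: by end_near. Qed.

(** The fraction [1 / (1 + s)] lies in [0, 1], and the two bounds are its extreme
    values 1 and 0. *)
Lemma separation_bounds (p s : R) : 0 <= p -> p <= 1 -> 0 <= s ->
  p ^+ 2 <= p * (1 - (1 - p) / (1 + s)) <= p.
Proof.
move=> p0 p1 s0; have t0 : 0 <= (1 + s)^-1 by rewrite invr_ge0 addr_ge0.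
have t1 : (1 + s)^-1 <= 1 by rewrite invf_le1 ?lerDl // ltr_wpDr.
move: ((1 + s)^-1) t0 t1 => t t0 t1; apply/andP; split.
  by rewrite expr2 ler_wpM2l // lerBrDr -lerBrDl ler_piMr // subr_ge0.
by rewrite ler_piMr // lerBlDr lerDl mulr_ge0 // subr_ge0.
Qed.

(** The three regimes of a leaf of weight [n ^ b] for [q = n ^ a]; when the
    two exponents agree, the limit is governed by the rest of the graph, through
    [s]. *)
Lemma separation_cvg (u s : nat -> R) a b :
  (\forall n \near \oo, 0 <= s n /\
     u n = natshare a b n * (1 - (1 - natshare a b n) / (1 + s n))) ->
  [/\ a < b -> u n @[n --> \oo] --> (0 : R),
      b < a -> u n @[n --> \oo] --> (1 : R) &
      forall l : R, a = b -> (1 + s n)^-1 @[n --> \oo] --> l ->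
        u n @[n --> \oo] --> 2^-1 * (1 - 2^-1 * l)].
Proof.
move=> us.
have bounds : \forall n \near \oo, natshare a b n ^+ 2 <= u n <= natshare a b n.
  near=> n; have [|s0 ->] := near us n; first by [].
  by apply: separation_bounds; rewrite ?natshare_ge0 ?natshare_le1 //;
    near: n; exact: nbhs_infty_gt.
have sandwich (l : R) : l ^+ 2 = l -> natshare a b n @[n --> \oo] --> l ->
    u n @[n --> \oo] --> l.
  (* The limits of interest, 0 and 1, are the solutions of [l ^+ 2 = l]. *)
  move=> ll pl; apply: (squeeze_cvgr bounds _ pl).
  suff: natshare a b n ^+ 2 @[n --> \oo] --> l ^+ 2 by rewrite ll.
  exact: (cvgM pl pl).
split=> [/natshare_cvg0|/natshare_cvg1|l ab sl].
- by apply: sandwich; rewrite expr0n.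
- by apply: sandwich; rewrite expr1n.
have uE : \forall n \near \oo, 2^-1 * (1 - 2^-1 * (1 + s n)^-1) = u n.
  near=> n; have [|s0 ->] := near us n; first by [].
  rewrite -ab natshare_id; last by near: n; exact: nbhs_infty_gt.
  by congr (_ * (1 - _ * _)); lra.
apply: cvg_trans; first by apply: near_eq_cvg uE.
apply: cvgM; first exact: cvg_cst.
by apply: cvgB; [exact: cvg_cst|apply: cvgM => //; exact: cvg_cst].
Unshelve. all: by end_near. Qed.

(** [hub_weight] of the community star graph for [q = n ^ a] and [w = n ^ b]. *)
Definition csg_hub k a b (n : nat) : R :=
  k%:R / (n%:R `^ a + 1) + (n.-1 - k)%:R * natshare b a n.

Lemma csg_hub_ge0 k a b n : 0 <= csg_hub k a b n.
Proof.
by rewrite addr_ge0 ?mulr_ge0 ?natshare_ge0 ?invr_ge0 ?addr_ge0 ?powR_ge0.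
Qed.

(** A leaf of weight [w] contributes [1 / (1 + n ^ (a - b))], which is at least
    half of [n ^ min(b - a, 0)], and at least [n / 2] leaves have weight [w] once
    [n >= 2 * k + 2].  Hence [csg_hub] is at least a quarter of a positive power
    of [n]. *)
Lemma csg_hub_cvgy k a b : a < b + 1 ->
  (1 + csg_hub k a b n)^-1 @[n --> \oo] --> (0 : R).
Proof.
move=> ab; set d := Num.min (b - a) 0.
have d1 : 0 < 1 + d.
  by rewrite /d; case: (leP (b - a) 0) => _; lra.
apply: (@squeeze_cvgr _ _ _ _ (fun=> 0) (fun n => 4 * n%:R `^ - (1 + d))).
- near=> n; have h0 := csg_hub_ge0 k a b n.
  have n0 : (0 < n)%N by near: n; exact: nbhs_infty_gt.
  have n0' : (0 : R) < n%:R by rewrite ltr0n.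
  have n1 : (1 : R) <= n%:R by rewrite ler1n.
  have nk : (k.*2.+2 <= n)%N by near: n; exact: nbhs_infty_ge.
  apply/andP; split; first by rewrite invr_ge0 addr_ge0.
  have sh : n%:R `^ d / 2 <= natshare b a n.
    rewrite natshareE // -[a - b]opprB powRN.
    have := powR_gt0 (b - a) n0'.
    have := powR_gt0 d n0'.
    have := ler_powR n1 (_ : d <= 0); rewrite powRr0 => /(_ _) d_le1.
    have := ler_powR n1 (_ : d <= b - a) => d_leba.
    have /d_le1 {}d_le1 : d <= 0 by rewrite /d ge_min lexx orbT.
    have /d_leba {}d_leba : d <= b - a by rewrite /d ge_min lexx.
    move: (n%:R `^ (b - a)) (n%:R `^ d) d_le1 d_leba => y z z1 zy z0 y0.
    have -> : (1 + y^-1)^-1 = y / (y + 1).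
      by field; rewrite !gt_eqF // addr_gt0.
    by rewrite ler_pdivlMr ?addr_gt0 //; nra.
  have half : n%:R / 2 <= ((n.-1 - k)%:R : R).
    rewrite ler_pdivrMr // -natrM ler_nat; lia.
  have hub : n%:R `^ (1 + d) / 4 <= csg_hub k a b n.
    rewrite powRD ?(gt_eqF n0') ?implybT // powRr1 ?ler0n //.
    apply: (@le_trans _ _ ((n.-1 - k)%:R * natshare b a n)).
      have -> : n%:R * n%:R `^ d / 4 = (n%:R / 2) * (n%:R `^ d / 2) by field.
      by apply: ler_pM; rewrite ?divr_ge0 ?powR_ge0.
    by rewrite lerDr divr_ge0 ?addr_ge0 ?powR_ge0.
  have := powR_gt0 (1 + d) n0'; rewrite powRN => N0.
  rewrite -[4]invrK -invfM lef_pV2 ?posrE ?mulr_gt0 ?ltr_wpDr //.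
  by lra.
- exact: cvg_cst.
- suff: (4 * n%:R `^ - (1 + d))%R @[n --> \oo] --> (4 * 0 : R) by rewrite mulr0.
  apply: cvgM; first exact: cvg_cst.
  by apply: natpow_cvg0; rewrite oppr_lt0.
Unshelve. all: by end_near. Qed.

(** With [q = 1], the second term of [csg_hub] is
    [(n ^ (1 + b) - (k + 1) * n ^ b) / (1 + n ^ b)], where [n ^ b] tends
    to 0. *)
Lemma csg_hub_cvg k b (l : R) : b < 0 -> n%:R `^ (1 + b) @[n --> \oo] --> l ->
  csg_hub k 0 b n @[n --> \oo] --> k%:R / 2 + l.
Proof.
move=> b0 bl.
have hubE : \forall n \near \oo,
    k%:R / 2 + (n%:R `^ (1 + b) - k.+1%:R * n%:R `^ b) / (1 + n%:R `^ b) =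
    csg_hub k 0 b n.
  near=> n; have kn : (k.+1 < n)%N by near: n; exact: nbhs_infty_gt.
  have n0 : (0 : R) < n%:R by rewrite ltr0n (leq_ltn_trans _ kn).
  rewrite /csg_hub /natshare powRr0 (_ : 1 + 1 = 2) //; congr (_ + _).
  rewrite powRD ?(gt_eqF n0) ?implybT // powRr1 ?ler0n //.
  (* The truncated subtractions are exact because [k + 1 < n]. *)
  have -> : (n.-1 - k)%:R = n%:R - k.+1%:R :> R.
    by rewrite -natrB 1?ltnW //; congr (_%:R); lia.
  by field; rewrite gt_eqF // addr_gt0 // powR_gt0.
apply: cvg_trans; first by apply: near_eq_cvg hubE.
apply: cvgD; first exact: cvg_cst.
have -> : l = (l - k.+1%:R * 0) / (1 + 0) by rewrite mulr0 subr0 addr0 divr1.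
have b_cvg := natpow_cvg0 b0.
apply: cvgM.
  by apply: cvgB => //; apply: cvgM => //; exact: cvg_cst.
apply: cvgV; first by rewrite addr0 oner_neq0.
by apply: cvgD => //; exact: cvg_cst.
Unshelve. all: by end_near. Qed.

(** The exponent [c] is 0 for a leaf of the community and [b] for any other leaf,
    so that both kinds of leaves are treated together. *)
Lemma U_csg_natpow k n (A : {set 'I_n.-1}) (i : 'I_n.-1) a b c :
  (0 < n)%N -> #|A| = k -> csg_wt A (n%:R `^ b) i = n%:R `^ c ->
  U_csg A (n%:R `^ a) (n%:R `^ b) (star_center n) (Some i) =
  natshare a c n * (1 - (1 - natshare a c n) / (1 + csg_hub k a b n)).
Proof.
rewrite -(ltr0n R) => n0 <- wi; rewrite U_csgE ?powR_gt0 // wi.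
by rewrite /csg_hub /natshare [n%:R `^ b + _]addrC.
Qed.
End Limits.

Local Open Scope classical_set_scope.
Local Open Scope ring_scope.

Theorem theorem6 (R : realType) (k : nat) (hk : (1 <= k)%N) (alpha beta : R)
    (A : forall n : nat, {set 'I_n.-1})
    (hA : forall n : nat, (k.+1 < n)%N -> #|A n| = k)
    (x y : forall n : nat, star_vertex n)
    (hx : forall n : nat, (k.+1 < n)%N ->
       exists2 i : 'I_n.-1, i \in A n & x n = Some i)
    (hy : forall n : nat, (k.+1 < n)%N ->
       exists2 i : 'I_n.-1, i \notin A n & y n = Some i) :
  [/\ alpha < 0 ->
        U_csg (A n) (n%:R `^ alpha) (n%:R `^ beta) (star_center n) (x n)
          @[n --> \oo] --> (0 : R),
      alpha = 0 -> -1 < beta ->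
        U_csg (A n) (n%:R `^ alpha) (n%:R `^ beta) (star_center n) (x n)
          @[n --> \oo] --> (1 / 2 : R),
      alpha = 0 -> beta = -1 ->
        U_csg (A n) (n%:R `^ alpha) (n%:R `^ beta) (star_center n) (x n)
          @[n --> \oo] --> ((k%:R + 3) / (2 * k%:R + 8) : R),
      alpha = 0 -> beta < -1 ->
        U_csg (A n) (n%:R `^ alpha) (n%:R `^ beta) (star_center n) (x n)
          @[n --> \oo] --> ((k%:R + 1) / (2 * k%:R + 4) : R)
    & 0 < alpha ->
        U_csg (A n) (n%:R `^ alpha) (n%:R `^ beta) (star_center n) (x n)
          @[n --> \oo] --> (1 : R)] /\
  [/\ alpha < beta ->
        U_csg (A n) (n%:R `^ alpha) (n%:R `^ beta) (star_center n) (y n)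
          @[n --> \oo] --> (0 : R),
      alpha = beta ->
        U_csg (A n) (n%:R `^ alpha) (n%:R `^ beta) (star_center n) (y n)
          @[n --> \oo] --> (1 / 2 : R)
    & beta < alpha ->
        U_csg (A n) (n%:R `^ alpha) (n%:R `^ beta) (star_center n) (y n)
          @[n --> \oo] --> (1 : R)].
Proof.
set S := csg_hub k alpha beta.
have xE : \forall n \near \oo, 0 <= S n /\
    U_csg (A n) (n%:R `^ alpha) (n%:R `^ beta) (star_center n) (x n) =
    natshare alpha 0 n * (1 - (1 - natshare alpha 0 n) / (1 + S n)).
  near=> n; have kn : (k.+1 < n)%N by near: n; exact: nbhs_infty_gt.
  split; first exact: csg_hub_ge0.
  have [i iA ->] := hx n kn; apply: U_csg_natpow (hA n kn) _.
    exact: leq_ltn_trans kn.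
  by rewrite /csg_wt iA powRr0.
have yE : \forall n \near \oo, 0 <= S n /\
    U_csg (A n) (n%:R `^ alpha) (n%:R `^ beta) (star_center n) (y n) =
    natshare alpha beta n * (1 - (1 - natshare alpha beta n) / (1 + S n)).
  near=> n; have kn : (k.+1 < n)%N by near: n; exact: nbhs_infty_gt.
  split; first exact: csg_hub_ge0.
  have [i iA ->] := hy n kn; apply: U_csg_natpow (hA n kn) _.
    exact: leq_ltn_trans kn.
  by rewrite /csg_wt (negbTE iA).
have [x0 x1 xmid] := separation_cvg xE.
have [y0 y1 ymid] := separation_cvg yE.
have half : 2^-1 * (1 - 2^-1 * 0) = 1 / 2 :> R by rewrite mulr0 subr0 mulr1 div1r.
have k0 : 0 <= k%:R :> R by [].
have hub_lim (l : R) : 0 <= l -> alpha = 0 -> beta < 0 ->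
    n%:R `^ (1 + beta) @[n --> \oo] --> l ->
    (1 + S n)^-1 @[n --> \oo] --> (1 + (k%:R / 2 + l))^-1.
  move=> l0 a0 b0 bl; apply: cvgV; first by rewrite gt_eqF //; lra.
  by apply: cvgD; [exact: cvg_cst|rewrite /S a0; exact: csg_hub_cvg].
split; split=> //.
- move=> a0 b1; rewrite -half; apply: xmid => //.
  by apply: csg_hub_cvgy; lra.
- move=> a0 b1.
  have -> : (k%:R + 3) / (2 * k%:R + 8) =
      2^-1 * (1 - 2^-1 * (1 + (k%:R / 2 + 1))^-1) :> R.
    by field; rewrite !gt_eqF //; lra.
  apply: xmid => //; apply: hub_lim => //; first by lra.
  rewrite b1 subrr; have -> : (fun n => n%:R `^ (0 : R)) = (fun=> 1 : R).
    by apply/funext => n; rewrite powRr0.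
  exact: cvg_cst.
- move=> a0 b1.
  have -> : (k%:R + 1) / (2 * k%:R + 4) =
      2^-1 * (1 - 2^-1 * (1 + (k%:R / 2 + 0))^-1) :> R.
    by field; rewrite !gt_eqF //; lra.
  apply: xmid => //; apply: hub_lim => //; first by lra.
  by apply: natpow_cvg0; lra.
- move=> ab; rewrite -half; apply: ymid => //.
  by apply: csg_hub_cvgy; lra.
Unshelve. all: by end_near. Qed.
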